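(* Let $\mathcal F\subset(\Sigma_T\times\Sigma_T)^*$ be the caret-type language of Thompson's group $F$, where $\Sigma_T=\{e,r,(,),a,b\}$. Then the normal form $\mathcal F$ for $F$ is quasigeodesic with respect to $X=\{x_0^{\pm1},x_1^{\pm1}\}$: there is a constant $D$ such that $|u|\le D(\|u\|_X+1)$ for all $u\in\mathcal F$, where $|u|$ is the number of letters (pairs) in $u$ and $\|u\|_X$ is the word length over $X$ of the element of $F$ represented by $u$.
   Context: Thompson's group. $F$ is the group of piecewise linear homeomorphisms of $[0,1]$ (orientation preserving) with finitely many linear pieces, breakpoints with dyadic rational coordinates, and slopes powers of $2$; the product $gh$ is the composition $g\circ h$ ($h$ applied first). A finite rooted binary tree (with at least one caret) has carets: a caret is a non-leaf vertex together with its left and right downward edges. A caret $D$ is the left (right) child of caret $C$ if the vertex of $D$ is the endpoint of the left (right) edge of $C$. The tree determines a dyadic subdivision of $[0,1]$: the root corresponds to $[0,1]$, the two edges of a caret bisect its interval, and the leaves, from left to right, give the subintervals. A pair $(T,S)$ of such trees with the same number of carets represents the element of $F$ mapping the $i$-th leaf interval of $T$ affinely onto the $i$-th leaf interval of $S$ for all $i$. Carets of a tree are numbered in infix order (left subtree, then the caret, then right subtree). A caret is exposed if it has no children. The pair $(T,S)$ is reduced if no caret number $n$ is such that caret $n$ is exposed in both $T$ and $S$, except that the pair of single-caret trees is regarded as the reduced pair for the identity; each element of $F$ has a unique reduced pair. Caret types. A caret is exterior if at least one of its edges lies on the left or right side of the tree (this includes the root), and interior otherwise. The root caret has type $r$;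 every other exterior caret has type $e$. Call an interior caret ''of the first kind'' if it is the left child of an interior caret or a child of an exterior caret, and ''of the second kind'' otherwise. An interior caret of the first kind has type $($ if it has a right child and $a$ if it has none; an interior caret of the second kind has type $b$ if it has a right child and $)$ if it has none. The word of a tree is the list of its caret types in infix order, a word over $\Sigma_T$. For $g\in F$ with reduced pair $(T,S)$, $\nu(g)\in(\Sigma_T\times\Sigma_T)^*$ is the word whose $i$-th letter is $\binom{t_i}{s_i}$, where $t_i,s_i$ are the $i$-th letters of the words of $T$ and $S$. The caret-type language is $\mathcal F=\{\nu(g)\mid g\in F\}$, and $\nu(g)$ is said to represent $g$. Generators. $x_0$ is the element with $\nu(x_0)=\binom{r}{e}\binom{e}{r}$ and $x_1$ the element with $\nu(x_1)=\binom{r}{r}\binom{e}{a}\binom{e}{e}$; these generate $F$. *)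

(* Defs.v *)
From HB Require Import structures.
From mathcomp Require Import all_boot all_order all_algebra.
From mathcomp Require Import all_classical all_reals topology normedtype realfun.
From mathcomp Require Import ring lra.

Set Implicit Arguments.
Unset Strict Implicit.
Unset Printing Implicit Defensive.

Import Order.TTheory GRing.Theory Num.Theory.
Import numFieldNormedType.Exports.

Local Open Scope classical_set_scope.
Local Open Scope ring_scope.

Definition unit_interval (R : realType) : set R := `[0, 1].

Arguments unit_interval : clear implicits.

Definition homeomorphism (X Y : topologicalType) (f : X -> Y) : Prop :=
  continuous f /\
  exists g : Y -> X, [/\ continuous g, cancel f g & cancel g f].

Section Thompson.
Context {R : realType}.
Local Notation I := (unit_interval R).

Definition dyadic (x : R) : Prop :=
  exists (m : int) (n : nat), x = m%:~R / 2 ^+ n.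

Definition increasing (f : I -> I) : Prop :=
  {homo f : x y / \val x < \val y}.

(* [B] lists the possible breakpoints: on each segment of [0, 1] with no point
   of [B] in its interior, [f] is affine, with slope a power of 2. *)
Definition dyadic_pl (f : I -> I) : Prop :=
  exists B : seq R,
    (forall b, b \in B -> dyadic b) /\
    forall x y : I, \val x < \val y ->
      (forall b, b \in B -> ~~ (\val x < b < \val y)) ->
      exists (k : int) (c : R), forall z : I,
        \val x <= \val z <= \val y -> \val (f z) = 2 ^ k * \val z + c.

Definition is_thompson (f : I -> I) : Prop :=
  [/\ homeomorphism f, increasing f & dyadic_pl f].

Lemma valI_ge0 (x : I) : 0 <= \val x.
Proof. by case: x => x /=; rewrite inE /unit_interval /= in_itv /= => /andP[]. Qed.

Lemma valI_le1 (x : I) : \val x <= 1.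
Proof. by case: x => x /=; rewrite inE /unit_interval /= in_itv /= => /andP[]. Qed.

Lemma memI (x : R) : 0 <= x -> x <= 1 -> x \in I.
Proof. by move=> x0 x1; rewrite inE /unit_interval /= in_itv /= x0 x1. Qed.

Lemma increasing_lt (f : I -> I) : increasing f ->
  forall x y, (\val (f x) < \val (f y)) = (\val x < \val y).
Proof.
move=> fi x y; apply/idP/idP; last exact: fi.
case: (ltgtP (\val x) (\val y)) => //.
  by move/fi/lt_trans => h /h; rewrite ltxx.
by move/val_inj => ->; rewrite ltxx.
Qed.

Lemma increasing_le (f : I -> I) : increasing f ->
  forall x y, (\val (f x) <= \val (f y)) = (\val x <= \val y).
Proof. by move=> fi x y; rewrite !leNgt increasing_lt. Qed.

Lemma dyadicD x y : dyadic x -> dyadic y -> dyadic (x + y).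
Proof.
move=> [m [n ->]] [m' [n' ->]]; exists (m * 2 ^+ n' + m' * 2 ^+ n), (n + n')%N.
rewrite rmorphD !rmorphM !rmorphXn /= exprD.
have h1 : (2 : R) ^+ n != 0 by rewrite expf_neq0 ?pnatr_eq0.
have h2 : (2 : R) ^+ n' != 0 by rewrite expf_neq0 ?pnatr_eq0.
by field; rewrite h1 h2.
Qed.

Lemma dyadicM x y : dyadic x -> dyadic y -> dyadic (x * y).
Proof.
move=> [m [n ->]] [m' [n' ->]]; exists (m * m'), (n + n')%N.
by rewrite rmorphM /= exprD invfM; ring.
Qed.

Lemma dyadic_int (m : int) : dyadic m%:~R.
Proof. by exists m, 0%N; rewrite expr0 divr1. Qed.

Lemma dyadic0 : dyadic 0.
Proof. exact: (dyadic_int 0). Qed.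

Lemma dyadicN x : dyadic x -> dyadic (- x).
Proof. by move=> [m [n ->]]; exists (- m), n; rewrite rmorphN mulNr. Qed.

Lemma dyadicX (k : int) : dyadic (2 ^ k).
Proof.
case: k => n; first by exists (2 ^+ n), 0%N; rewrite expr0 divr1 rmorphXn.
by exists 1, n.+1; rewrite mul1r.
Qed.

Lemma last_breakpoint (B : seq R) (d : R) : 0 < d ->
  exists m, [/\ 0 <= m, m < d, (m = 0) \/ (m \in B) &
                forall b, b \in B -> ~~ (m < b < d)].
Proof.
move=> d0; elim: B => [|b B [m [m0 md mB mm]]].
  by exists 0; split => //; left.
case: (boolP (m < b < d)) => [/andP[mb bd]|mbd].
  exists b; split => //; first exact: le_trans (ltW mb).
    by right; rewrite mem_head.
  move=> b'; rewrite inE => /predU1P[->|b'B]; first by rewrite ltxx.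
  apply/negP => /andP[bb' b'd]; move/negP: (mm _ b'B); apply.
  by rewrite (lt_trans mb bb') b'd.
exists m; split => //.
  by case: mB => [|h]; [left|right; rewrite inE h orbT].
by move=> b'; rewrite inE => /predU1P[->|/mm].
Qed.

Lemma count_lt_mono (B : seq R) (m x : R) : m \in B -> m < x ->
  (count (fun b => (b < m)%R) B < count (fun b => (b < x)%R) B)%N.
Proof.
move=> mB mx; elim: B mB => // b B IH; rewrite inE /= => /predU1P[<-|mB].
  rewrite ltxx mx add0n add1n ltnS; apply: sub_count => b' /= /lt_trans; exact.
rewrite -addnS; apply: leq_add; last exact: IH.
by case: (ltP b m) => // bm; rewrite (lt_trans bm mx).
Qed.

Lemma thompson_val0 (f g : I -> I) : increasing f -> cancel g f ->
  forall x, \val x = 0 -> \val (f x) = 0.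
Proof.
move=> fi gK x x0; apply/eqP; rewrite eq_le valI_ge0 andbT.
have m0 : 0 \in I by apply: memI.
pose z : I := exist _ 0 m0.
have -> : 0 = \val (f (g z)) by rewrite gK.
by rewrite increasing_le // x0 valI_ge0.
Qed.

Lemma dyadic_pl_dyadic (f g : I -> I) : increasing f -> cancel g f ->
  dyadic_pl f -> forall x : I, dyadic (\val x) <-> dyadic (\val (f x)).
Proof.
move=> fi gK [B [dB pB]] x.
have [n] := ubnP (count (fun b => b < \val x) B).
elim: n x => // n IH x; rewrite ltnS => cx.
have := valI_ge0 x; rewrite le_eqVlt => /predU1P[x0|x0].
  by rewrite (thompson_val0 fi gK (esym x0)) -x0; split.
have [m [m0 mx mB mm]] := last_breakpoint B x0.
have mI : m \in I by apply: memI => //; apply: le_trans (ltW mx) (valI_le1 x).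
pose z : I := exist _ m mI.
have [k [c kc]] := pB z x mx mm.
have fz : \val (f z) = 2 ^ k * m + c by apply: kc; rewrite /= lexx ltW.
have fx : \val (f x) = 2 ^ k * \val x + c by apply: kc; rewrite /= lexx andbT ltW.
have dz : dyadic m by case: mB => [->|/dB//]; exact: dyadic0.
have dfz : dyadic (\val (f z)).
  case: mB => [zE|mB]; first by rewrite (thompson_val0 fi gK) //; exact: dyadic0.
  apply/(IH z) => //; apply: leq_trans cx.
  by apply: count_lt_mono.
have fE : \val (f x) = \val (f z) + 2 ^ k * (\val x - m) by rewrite fx fz; ring.
have xE : \val x = m + 2 ^ (- k) * (\val (f x) - \val (f z)).
  rewrite fE addrAC subrr add0r mulrA -expfzDr ?pnatr_eq0 // addNr expr0z mul1r.
  by rewrite addrC subrK.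
split=> [dx|dfx]; [rewrite fE|rewrite xE].
  by apply/dyadicD/dyadicM/dyadicD/dyadicN => //; exact: dyadicX.
by apply/dyadicD/dyadicM/dyadicD/dyadicN => //; exact: dyadicX.
Qed.

Lemma dyadic_pl_comp (f g h : I -> I) : increasing g -> increasing f ->
  cancel h g -> cancel g h -> dyadic_pl f -> dyadic_pl g -> dyadic_pl (f \o g).
Proof.
move=> gi fi hK gK [B [dB pB]] pg; have [C [dC pC]] := pg.
exists (C ++ [seq \val (h x) | x <- pmap (insub : R -> option I) B]); split.
  move=> b; rewrite mem_cat => /orP[/dC//|/mapP[x]].
  rewrite mem_pmap_sub => /dB dx ->.
  by apply/(dyadic_pl_dyadic gi hK pg); rewrite hK.
move=> x y xy Bxy.
have [k [c kc]] : exists (k : int) (c : R), forall z : I,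
    \val x <= \val z <= \val y -> \val (g z) = 2 ^ k * \val z + c.
  by apply: pC => // b bC; apply: Bxy; rewrite mem_cat bC.
have [||l [d ld]] := pB (g x) (g y); first exact: gi.
  move=> b bB; apply/negP => /andP[xb byy].
  have bI : b \in I.
    apply: memI; first exact: le_trans (valI_ge0 _) (ltW xb).
    exact: le_trans (ltW byy) (valI_le1 _).
  pose w : I := exist _ b bI.
  have /negP : ~~ (\val x < \val (h w) < \val y).
    apply: Bxy; rewrite mem_cat; apply/orP; right; apply/mapP; exists w => //.
    by rewrite mem_pmap_sub.
  apply; rewrite -(increasing_lt gi x) -(increasing_lt gi _ y) hK.
  by apply/andP.
exists (l + k), (2 ^ l * c + d) => z xzy.
rewrite [LHS]ld ?(increasing_le gi) // kc // expfzDr ?pnatr_eq0 //.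
by rewrite mulrDr mulrA addrA.
Qed.

Lemma increasing_can (f g : I -> I) : increasing f -> cancel g f -> increasing g.
Proof. by move=> fi gK x y xy; rewrite -(increasing_lt fi) !gK. Qed.

Lemma dyadic_pl_inv (f g : I -> I) : increasing f ->
  cancel f g -> cancel g f -> dyadic_pl f -> dyadic_pl g.
Proof.
move=> fi fK gK pf; have [B [dB pB]] := pf.
have gi := increasing_can fi gK.
exists [seq \val (f x) | x <- pmap (insub : R -> option I) B]; split.
  move=> b /mapP[x]; rewrite mem_pmap_sub => /dB dx ->.
  by apply/(dyadic_pl_dyadic fi gK pf x).
move=> x y xy Bxy.
have [||k [c kc]] := pB (g x) (g y); first exact: gi.
  move=> b bB; apply/negP => /andP[xb byy].
  have bI : b \in I.
    apply: memI; first exact: le_trans (valI_ge0 _) (ltW xb).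
    exact: le_trans (ltW byy) (valI_le1 _).
  pose w : I := exist _ b bI.
  have /negP : ~~ (\val x < \val (f w) < \val y).
    by apply: Bxy; apply/mapP; exists w => //; rewrite mem_pmap_sub.
  apply; rewrite -(increasing_lt gi x) -(increasing_lt gi _ y) fK.
  by apply/andP.
exists (- k), (- (2 ^ (- k) * c)) => z xzy.
have := kc (g z); rewrite gK !(increasing_le gi) => /(_ xzy) ->.
rewrite mulrDr mulrA -expfzDr ?pnatr_eq0 // addNr expr0z mul1r.
by rewrite addrK.
Qed.

Lemma is_thompson_id : is_thompson (@idfun I).
Proof.
split => //.
  by split; [|exists idfun; split => //]; move=> x; exact: cvg_id.
exists [::]; split => // x y _ _; exists 0, 0 => z _.
by rewrite expr0z mul1r addr0.
Qed.

Lemma is_thompson_comp (f g : I -> I) :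
  is_thompson f -> is_thompson g -> is_thompson (f \o g).
Proof.
move=> [[fc [f' [f'c fK f'K]]] fi fp] [[gc [g' [g'c gK g'K]]] gi gp]; split.
- split; first by move=> x; apply: continuous_comp; [exact: gc|exact: fc].
  exists (g' \o f'); split.
  + by move=> x; apply: continuous_comp; [exact: f'c|exact: g'c].
  + by move=> x /=; rewrite fK gK.
  + by move=> x /=; rewrite g'K f'K.
- by move=> x y xy; apply/fi/gi.
- exact: dyadic_pl_comp gi fi g'K gK fp gp.
Qed.

Lemma is_thompson_inv (f : I -> I) : is_thompson f ->
  exists g, [/\ is_thompson g, cancel f g & cancel g f].
Proof.
move=> [[fc [g [gc fK gK]]] fi fp]; exists g; split => //; split.
- by split=> //; exists f.
- exact: increasing_can fi gK.
- exact: dyadic_pl_inv fi fK gK fp.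
Qed.

End Thompson.

Record thompson (R : realType) := Thompson {
  thompson_fun :> unit_interval R -> unit_interval R;
  _ : `[< is_thompson thompson_fun >] }.

HB.instance Definition _ (R : realType) := [isSub for @thompson_fun R].
HB.instance Definition _ (R : realType) := [Choice of thompson R by <:].

Section ThompsonGroup.
Context {R : realType}.
Implicit Types f g : thompson R.

Lemma thompsonP f : is_thompson f.
Proof. by case: f => f fP; exact: (asboolW fP). Qed.

Definition to_thompson (h : unit_interval R -> unit_interval R)
  (hP : is_thompson h) : thompson R := Thompson (asboolT hP).

Definition thompson_one : thompson R := to_thompson is_thompson_id.

Definition thompson_mul f g : thompson R :=
  to_thompson (is_thompson_comp (thompsonP f) (thompsonP g)).

Definition thompson_inv f : thompson R :=
  let h := cid (is_thompson_inv (thompsonP f)) in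
  to_thompson (let: And3 hP _ _ := projT2 h in hP).

Lemma thompson_invK f : cancel f (thompson_inv f).
Proof. by rewrite /thompson_inv /=; case: cid => g []. Qed.

Lemma thompson_invVK f : cancel (thompson_inv f) f.
Proof. by rewrite /thompson_inv /=; case: cid => g []. Qed.

Lemma thompson_ext f g : f =1 g -> f = g.
Proof. by move=> fg; apply/val_inj/funext. Qed.

Lemma thompson_mulA : associative thompson_mul.
Proof. by move=> f g h; apply: thompson_ext. Qed.

Lemma thompson_mul1 : left_id thompson_one thompson_mul.
Proof. by move=> f; apply: thompson_ext. Qed.

Lemma thompson_mulr1 : right_id thompson_one thompson_mul.
Proof. by move=> f; apply: thompson_ext. Qed.

Lemma thompson_mulV : left_inverse thompson_one thompson_inv thompson_mul.
Proof. by move=> f; apply: thompson_ext => x /=; exact: thompson_invK. Qed.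

Lemma thompson_mulrV : right_inverse thompson_one thompson_inv thompson_mul.
Proof. by move=> f; apply: thompson_ext => x /=; exact: thompson_invVK. Qed.

HB.instance Definition _ := isGroup.Build (thompson R)
  thompson_mulA thompson_mul1 thompson_mulr1 thompson_mulV thompson_mulrV.

End ThompsonGroup.

Inductive tree := Leaf | Caret of tree & tree.

(* A vertex is the list of turns leading to it from the root ([false] for left,
   [true] for right), the last turn coming first: the left and right edges of a
   caret at [v] end at [false :: v] and [true :: v]. *)
Definition vertex := seq bool.

Fixpoint carets_from (v : vertex) (t : tree) : seq vertex :=
  if t is Caret l r then
    carets_from (false :: v) l ++ v :: carets_from (true :: v) r
  else [::].

(* The carets of a tree, in infix order. *)
Definition carets (t : tree) : seq vertex := carets_from [::] t.

Definition has_left_child (t : tree) (v : vertex) := false :: v \in carets t.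
Definition has_right_child (t : tree) (v : vertex) := true :: v \in carets t.

Definition exposed (t : tree) (v : vertex) : bool :=
  ~~ has_left_child t v && ~~ has_right_child t v.

Definition single_caret : tree := Caret Leaf Leaf.

Definition reduced (T S : tree) : Prop :=
  (T = single_caret /\ S = single_caret) \/
  forall n, (n < size (carets T))%N ->
    ~~ (exposed T (nth [::] (carets T) n) && exposed S (nth [::] (carets S) n)).

(* An edge lies on a side of the tree when its lower endpoint does. *)
Definition on_left_side (v : vertex) : bool := all negb v.
Definition on_right_side (v : vertex) : bool := all id v.

Definition exterior (v : vertex) : bool :=
  has (fun w => on_left_side w || on_right_side w) [:: false :: v; true :: v].
Definition interior (v : vertex) : bool := ~~ exterior v.

Definition first_kind (v : vertex) : bool :=
  if v is turn :: parent then
    (~~ turn && interior parent) || exterior parent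
  else false.

Inductive letter :=
  letter_e | letter_r | letter_open | letter_close | letter_a | letter_b.

Definition caret_type (t : tree) (v : vertex) : letter :=
  if v == [::] then letter_r
  else if exterior v then letter_e
  else if first_kind v then
    if has_right_child t v then letter_open else letter_a
  else
    if has_right_child t v then letter_b else letter_close.

Definition tree_word (t : tree) : seq letter :=
  [seq caret_type t v | v <- carets t].

Section TreePairs.
Context {R : realType}.
Local Notation I := (unit_interval R).

Fixpoint subdivision (t : tree) (a b : R) : seq (R * R) :=
  if t is Caret l r then
    subdivision l a ((a + b) / 2) ++ subdivision r ((a + b) / 2) b
  else [:: (a, b)].

Definition leaf_intervals (t : tree) : seq (R * R) := subdivision t 0 1.

(* The increasing affine map taking the segment [J] onto the segment [K]. *)
Definition affine_map (J K : R * R) (x : R) : R :=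
  K.1 + (x - J.1) * ((K.2 - K.1) / (J.2 - J.1)).

Definition pair_represents (T S : tree) (g : thompson R) : Prop :=
  [/\ T <> Leaf, S <> Leaf, size (carets T) = size (carets S) &
    forall i, (i < size (leaf_intervals T))%N ->
      let J := nth (0, 0) (leaf_intervals T) i in
      let K := nth (0, 0) (leaf_intervals S) i in
      forall x : I, J.1 <= \val x <= J.2 -> \val (g x) = affine_map J K (\val x)].

(* [nu g u] states that [u] is the word of [g]. *)
Definition nu (g : thompson R) (u : seq (letter * letter)) : Prop :=
  exists T S, [/\ pair_represents T S g, reduced T S &
                  u = zip (tree_word T) (tree_word S)].

Fixpoint chain (a : R) (s : seq (R * R)) (b : R) : Prop :=
  if s is J :: s' then
    [/\ J.1 = a, dyadic a, exists k : int, J.2 - J.1 = 2 ^ k & chain J.2 s' b]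
  else a = b.

Fixpoint pl_map (c : R) (s t : seq (R * R)) (x : R) : R :=
  match s, t with
  | J :: s', K :: t' =>
      if x <= J.2 then affine_map J K x else pl_map K.2 s' t' x
  | _, _ => c
  end.

Lemma chain_cat a b c s t : chain a s b -> chain b t c -> chain a (s ++ t) c.
Proof.
by elim: s a => [|J s IH] a /= => [->//|[? ? ? h] h']; split => //; exact: IH.
Qed.

Lemma chain_subdivision t a b (k : int) :
  dyadic a -> b - a = 2 ^ k -> chain a (subdivision t a b) b.
Proof.
elim: t a b k => [|l IHl r IHr] a b k da ab /=; first by split => //; exists k.
have e : (2 : R) ^ (k - 1) = 2 ^ k / 2 by rewrite expfzDr ?pnatr_eq0.
have e1 : (a + b) / 2 - a = 2 ^ (k - 1) by rewrite e -ab; field.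
have e2 : b - (a + b) / 2 = 2 ^ (k - 1) by rewrite e -ab; field.
apply: chain_cat (IHl _ _ _ da e1) (IHr _ _ _ _ e2).
have -> : (a + b) / 2 = a + 2 ^ (k - 1) by rewrite -e1; ring.
by apply: dyadicD => //; exact: dyadicX.
Qed.

Lemma size_subdivision t a b v :
  size (subdivision t a b) = (size (carets_from v t)).+1.
Proof.
elim: t a b v => //= l IHl r IHr a b v.
rewrite size_cat (IHl _ _ (false :: v)) (IHr _ _ (true :: v)).
by rewrite size_cat /= addSn.
Qed.

Lemma chain_lt J (k : int) : J.2 - J.1 = 2 ^ k -> J.1 < J.2 :> R.
Proof. by move=> e; rewrite -subr_gt0 e exprz_gt0. Qed.

Lemma chain_le a s b : chain a s b -> a <= b.
Proof.
elim: s a => [|J s IH] a /=; first by move=> ->.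
by move=> [<- _ [k /chain_lt/ltW h] /IH]; exact: le_trans.
Qed.

Lemma affine_map_lt J K x y : J.1 < J.2 -> K.1 < K.2 ->
  (affine_map J K x < affine_map J K y) = (x < y).
Proof.
move=> hJ hK; rewrite /affine_map ltrD2l ltr_pM2r ?ltrD2r //.
by rewrite divr_gt0 ?subr_gt0.
Qed.

Lemma affine_map_le J K x y : J.1 < J.2 -> K.1 < K.2 ->
  (affine_map J K x <= affine_map J K y) = (x <= y).
Proof. by move=> hJ hK; rewrite !leNgt affine_map_lt. Qed.

Lemma affine_map1 J K : affine_map J K J.1 = K.1.
Proof. by rewrite /affine_map subrr mul0r addr0. Qed.

Lemma affine_map2 J K : J.1 < J.2 -> affine_map J K J.2 = K.2.
Proof.
by move=> hJ; rewrite /affine_map mulrCA divff ?mulr1 ?subrKC // subr_eq0 gt_eqF.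
Qed.

Lemma affine_mapK J K x : J.1 < J.2 -> K.1 < K.2 ->
  affine_map K J (affine_map J K x) = x.
Proof.
rewrite /affine_map -subr_gt0 => hJ; rewrite -subr_gt0 => hK.
by field; rewrite !gt_eqF.
Qed.

Lemma pl_map_start a s b c t d : chain a s b -> chain c t d ->
  size s = size t -> pl_map c s t a = c.
Proof.
case: s t => [|J s] [|K t] //= [<- _ [k /chain_lt h] _] [<- _ _ _] _.
by rewrite ltW // affine_map1.
Qed.

Lemma pl_map_gt a s b c t d : chain a s b -> chain c t d -> size s = size t ->
  forall x, a < x -> x <= b -> c < pl_map c s t x.
Proof.
elim: s t a c => [|J s IH] [|K t] a c //=.
  by move=> -> _ _ x /lt_le_trans h /h; rewrite ltxx.
move=> [<- _ [k /chain_lt h] sb] [<- _ [l /chain_lt h'] td] [st] x ax xb.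
case: (leP x J.2) => xJ; first by rewrite -(affine_map1 J K) affine_map_lt.
by apply: lt_trans h' _; exact: (IH _ _ _ sb td st).
Qed.

Lemma pl_map_le a s b c t d : chain a s b -> chain c t d -> size s = size t ->
  forall x, a <= x -> x <= b -> c <= pl_map c s t x <= d.
Proof.
elim: s t a c => [|J s IH] [|K t] a c //=; first by move=> _ -> _ x _ _; rewrite lexx.
move=> [<- _ [k /chain_lt h] sb] [<- _ [l /chain_lt h'] td] [st] x ax xb.
case: (leP x J.2) => xJ.
  rewrite -{1}(affine_map1 J K) affine_map_le // ax.
  by apply: le_trans (chain_le td); rewrite -(affine_map2 K h) affine_map_le.
have /andP[h1 ->] := IH _ _ _ sb td st x (ltW xJ) xb.
by rewrite andbT (le_trans (ltW h')).
Qed.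

Lemma pl_map_lt a s b c t d : chain a s b -> chain c t d -> size s = size t ->
  forall x y, a <= x -> x < y -> y <= b -> pl_map c s t x < pl_map c s t y.
Proof.
elim: s t a c => [|J s IH] [|K t] a c //=.
  by move=> -> _ _ x y ax /(le_lt_trans ax)/lt_le_trans h /h; rewrite ltxx.
move=> [<- _ [k /chain_lt h] sb] [<- _ [l /chain_lt h'] td] [st] x y ax xy yb.
case: (leP x J.2) => xJ; case: (leP y J.2) => yJ.
- by rewrite affine_map_lt.
- apply: le_lt_trans (pl_map_gt sb td st yJ yb).
  by rewrite -(affine_map2 K h) affine_map_le.
- by have := lt_trans xJ xy; rewrite ltNge yJ.
- by apply: (IH _ _ _ sb td st) => //; exact: ltW.
Qed.

Lemma pl_mapK a s b c t d : chain a s b -> chain c t d -> size s = size t ->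
  forall x, a <= x -> x <= b -> pl_map a t s (pl_map c s t x) = x.
Proof.
elim: s t a c => [|J s IH] [|K t] a c //=.
  by move=> -> _ _ x bx xb; apply/eqP; rewrite eq_le bx xb.
move=> [<- _ [k /chain_lt h] sb] [<- _ [l /chain_lt h'] td] [st] x ax xb.
case: (leP x J.2) => xJ.
  by rewrite -{1}(affine_map2 K h) affine_map_le // xJ affine_mapK.
by rewrite leNgt (pl_map_gt sb td st xJ xb) /= (IH _ _ _ sb td st) // ltW.
Qed.

Lemma pl_map_cons_ge J s b K t d a c : chain a (J :: s) b -> chain c (K :: t) d ->
  size s = size t ->
  forall x, J.2 <= x -> pl_map c (J :: s) (K :: t) x = pl_map K.2 s t x.
Proof.
move=> /= [_ _ [k /chain_lt h] sb] [_ _ _ td] st x; rewrite le_eqVlt.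
move=> /predU1P[<-|/lt_geF -> //].
by rewrite lexx affine_map2 // (pl_map_start sb td st).
Qed.

Lemma chain_nth_ge a s b i : chain a s b -> (i < size s)%N -> a <= (nth (0, 0) s i).1.
Proof.
elim: s a i => [|J s IH] a [|i] //=; first by move=> [->].
move=> [<- _ [k /chain_lt/ltW h] sb] /(IH _ _ sb); exact: le_trans.
Qed.

Lemma pl_map_nth a s b c t d i : chain a s b -> chain c t d -> size s = size t ->
  (i < size s)%N ->
  let J := nth (0, 0) s i in let K := nth (0, 0) t i in
  forall x, J.1 <= x <= J.2 -> pl_map c s t x = affine_map J K x.
Proof.
elim: s t a c i => [|J s IH] [|K t] a c [|i] // sb td [st] ilt.
  by move=> /= x /andP[_ ->].
move=> J' K' x xJ; have [_ _ _ sb'] := sb; have [_ _ _ td'] := td.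
rewrite (pl_map_cons_ge sb td st); first exact: (IH _ _ _ _ sb' td' st ilt).
by case/andP: xJ => h _; apply: le_trans h; exact: chain_nth_ge sb' ilt.
Qed.

Lemma chain_dyadic a s b : chain a s b -> forall x, x \in unzip1 s -> dyadic x.
Proof.
elim: s a => //= J s IH a [-> da _ sb] x; rewrite inE => /predU1P[->//|].
exact: (IH _ sb).
Qed.

Lemma pl_map_affine a s b c t d : chain a s b -> chain c t d -> size s = size t ->
  forall x y, a <= x -> x < y -> y <= b ->
  (forall p, p \in unzip1 s -> ~~ (x < p < y)) ->
  exists (k : int) (m : R), forall z, x <= z <= y -> pl_map c s t z = 2 ^ k * z + m.
Proof.
elim: s t a c => [|J s IH] [|K t] a c //.
  by move=> /= -> _ _ x y ax /(le_lt_trans ax)/lt_le_trans h /h; rewrite ltxx.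
move=> sb td [st] x y ax xy yb nb.
have [_ _ [k hk] sb'] := sb; have [_ _ [l hl] td'] := td.
have [yJ|Jy] := leP y J.2.
  exists (l - k), (K.1 - J.1 * 2 ^ (l - k)) => z /andP[_ zy].
  rewrite /= (le_trans zy yJ) /affine_map hk hl expfzDr ?pnatr_eq0 //.
  by rewrite -invr_expz; ring.
have Jx : J.2 <= x.
  rewrite leNgt; apply/negP => xJ.
  case: s {IH} sb' st sb nb => [/= Jb|J' s [J'J _ _ _]] _ _ nb.
    by move: Jy; rewrite Jb ltNge yb.
  by have := nb J.2; rewrite /= J'J !inE eqxx orbT xJ Jy => /(_ isT).
have [|k' [m hm]] := IH _ _ _ sb' td' st x y Jx xy yb.
  by move=> p ps; apply: nb; rewrite inE ps orbT.
exists k', m => z xzy; rewrite (pl_map_cons_ge sb td st) ?hm //.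
by case/andP: xzy => h _; exact: le_trans h.
Qed.

Lemma pl_map_thompson s t : chain 0 s 1 -> chain 0 t 1 -> size s = size t ->
  exists g : thompson R, forall x : I, \val (g x) = pl_map 0 s t (\val x).
Proof.
have mem s' t' : chain 0 s' 1 -> chain 0 t' 1 -> size s' = size t' ->
    forall x : I, pl_map 0 s' t' (\val x) \in I.
  move=> cs ct st x.
  have /andP[h1 h2] := pl_map_le cs ct st (valI_ge0 x) (valI_le1 x).
  exact: memI.
move=> cs ct st.
pose f (x : I) : I := exist (fun z => z \in I) _ (mem _ _ cs ct st x).
pose g (x : I) : I := exist (fun z => z \in I) _ (mem _ _ ct cs (esym st) x).
have fK : cancel f g.
  by move=> x; apply/val_inj; exact: pl_mapK cs ct st _ (valI_ge0 x) (valI_le1 x).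
have gK : cancel g f.
  move=> x; apply/val_inj.
  exact: pl_mapK ct cs (esym st) _ (valI_ge0 x) (valI_le1 x).
have cont s' t' (cs' : chain 0 s' 1) (ct' : chain 0 t' 1) (st' : size s' = size t') :
    continuous (fun x : I => exist (fun z => z \in I) _ (mem _ _ cs' ct' st' x) : I).
  apply: continuous_comp_initial.
  have lt := pl_map_lt cs' ct' st'.
  apply/(@subspace_sigL_continuousP _ I _ (pl_map 0 s' t')).
  apply: segment_inc_surj_continuous.
    apply: le_mono_in => x y; rewrite !in_itv /= => /andP[x0 _] /andP[_ y1] xy.
    exact: lt.
  move=> y /=; rewrite in_itv /= => /andP[y0 y1].
  have e0 := pl_map_start cs' ct' st'.
  have /andP[_ e1] := pl_map_le cs' ct' st' ler01 (lexx 1).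
  rewrite e0 in y0; have {}y1 := le_trans y1 e1.
  exists (pl_map 0 t' s' y); last exact: pl_mapK ct' cs' (esym st') _ y0 y1.
  by rewrite /= in_itv /=; exact: pl_map_le ct' cs' (esym st') _ y0 y1.
have fP : is_thompson f.
  split; first by split; [exact: cont|exists g; split => //; exact: cont].
    by move=> x y xy; apply: (pl_map_lt cs ct st) => //; [exact: valI_ge0|exact: valI_le1].
  exists (unzip1 s); split; first exact: chain_dyadic cs.
  move=> x y xy nb.
  have [k [m h]] := pl_map_affine cs ct st (valI_ge0 x) xy (valI_le1 y) nb.
  by exists k, m => z /h.
by exists (to_thompson fP).
Qed.

Lemma pair_represents_exists T S : T <> Leaf -> S <> Leaf ->
  size (carets T) = size (carets S) -> exists g, pair_represents T S g.
Proof.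
move=> nT nS TS.
have e : (1 : R) - 0 = 2 ^ 0 by rewrite subr0 expr0z.
have cT := chain_subdivision T dyadic0 e.
have cS := chain_subdivision S dyadic0 e.
have sTS : size (leaf_intervals T) = size (leaf_intervals S).
  by rewrite /leaf_intervals !(size_subdivision _ _ _ [::]) TS.
have [g hg] := pl_map_thompson cT cS sTS; exists g; split => // i iT J K x xJ.
by rewrite hg (pl_map_nth cT cS sTS iT).
Qed.

Lemma x0_exists :
  exists g, nu g [:: (letter_r, letter_e); (letter_e, letter_r)].
Proof.
pose T := Caret Leaf (Caret Leaf Leaf); pose S := Caret (Caret Leaf Leaf) Leaf.
have [//|//|//|g hg] := @pair_represents_exists T S.
by exists g, T, S; split => //; right; case => [|[|[]]].
Qed.

Lemma x1_exists :
  exists g, nu g [:: (letter_r, letter_r); (letter_e, letter_a);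
                     (letter_e, letter_e)].
Proof.
pose T := Caret Leaf (Caret Leaf (Caret Leaf Leaf)).
pose S := Caret Leaf (Caret (Caret Leaf Leaf) Leaf).
have [//|//|//|g hg] := @pair_represents_exists T S.
by exists g, T, S; split => //; right; case => [|[|[|[]]]].
Qed.

End TreePairs.

Definition caret_type_language (R : realType) : set (seq (letter * letter)) :=
  [set u | exists g : thompson R, nu g u].
Arguments caret_type_language : clear implicits.

Definition x0 (R : realType) : thompson R := projT1 (cid (@x0_exists R)).
Definition x1 (R : realType) : thompson R := projT1 (cid (@x1_exists R)).

Definition generators (R : realType) : set (thompson R) :=
  [set x0 R; (x0 R)^-1%g; x1 R; (x1 R)^-1%g].
Arguments generators : clear implicits.

Definition is_product_of (G : groupType) (X : set G) (g : G) (n : nat) : Prop :=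
  exists w : seq G,
    [/\ forall x, x \in w -> X x, size w = n & g = (\prod_(x <- w) x)%g].

Definition word_length (G : groupType) (X : set G) (g : G) (n : nat) : Prop :=
  is_product_of X g n /\ forall m, is_product_of X g m -> (n <= m)%N.

(* Main.v *)
(** Call a standard dyadic interval bad for [g] if [g] does not map it affinely
    onto a standard dyadic interval. The map [g] sends an interval which is bad
    for [f * g] but not for [g] to one which is bad for [f], so the number of bad
    intervals is subadditive. For any tree pair representing [g] the bad
    intervals are among those of the carets of the source tree, hence there are
    at most 3 of them for a generator; and for a reduced pair other than the
    single-caret one all these carets are bad, because an exposed caret of the
    source tree which is not bad faces an exposed caret of the target tree. *)

Require Import Defs.
From mathcomp Require Import all_boot all_order all_algebra.
From mathcomp Require Import all_classical all_reals.
From mathcomp Require Import ring lra.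

Set Implicit Arguments.
Unset Strict Implicit.
Unset Printing Implicit Defensive.

Import Order.TTheory GRing.Theory Num.Theory.

(** * Carets and leaves in infix order *)

Section Trees.
Implicit Types (t : tree) (p v w : vertex).

Fixpoint leaves_from v t : seq vertex :=
  if t is Caret l r then
    leaves_from (false :: v) l ++ leaves_from (true :: v) r
  else [:: v].

Definition leaves t := leaves_from [::] t.

Lemma size_leaves_from p t : size (leaves_from p t) = (size (carets_from p t)).+1.
Proof.
elim: t p => //= l IHl r IHr p.
by rewrite !size_cat IHl IHr /= addSn.
Qed.

(** Since a vertex lists its last turn first, [suffix p v] says that [v] is [p] or a descendant of
    [p]. *)
Lemma carets_from_suffix p t v : v \in carets_from p t -> suffix p v.
Proof.
have suffix_tl b q u : suffix (b :: q) u -> suffix q u.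
  by apply: suffix_trans; exact: suffix_cons.
elim: t p => //= l IHl r IHr p.
rewrite mem_cat inE => /or3P[/IHl/suffix_tl//|/eqP->|/IHr/suffix_tl//].
exact: suffix_refl.
Qed.

Lemma leaves_from_suffix p t v : v \in leaves_from p t -> suffix p v.
Proof.
have suffix_tl b q u : suffix (b :: q) u -> suffix q u.
  by apply: suffix_trans; exact: suffix_cons.
elim: t p => [|l IHl r IHr] p /=; first by rewrite inE => /eqP->; exact: suffix_refl.
by rewrite mem_cat => /orP[/IHl/suffix_tl|/IHr/suffix_tl].
Qed.

(** Read backwards, [v] would be a path from the root that follows [p] and then turns both left and
    right. *)
Lemma suffix_children p v : suffix (false :: p) v -> suffix (true :: p) v -> False.
Proof.
move=> /suffixP[s ->] /suffixP[s' /(congr1 rev)] /eqP.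
by rewrite !rev_cat !rev_cons -!cats1 -!catA eqseq_cat // eqxx.
Qed.

Lemma suffix_child_neq p b : suffix (b :: p) p = false.
Proof. by apply/negP => /size_suffix; rewrite /= ltnn. Qed.

Lemma uniq_carets_from p t : uniq (carets_from p t).
Proof.
elim: t p => //= l IHl r IHr p; rewrite cat_uniq IHl /= IHr andbT.
apply/andP; split.
  rewrite negb_or; apply/andP; split.
    by apply/negP => /carets_from_suffix; rewrite suffix_child_neq.
  apply/hasPn => v /carets_from_suffix vr; apply/negP => /carets_from_suffix vl.
  exact: suffix_children vl vr.
by apply/negP => /carets_from_suffix; rewrite suffix_child_neq.
Qed.

Lemma leaf_notin_carets p t v : v \in leaves_from p t -> v \notin carets_from p t.
Proof.
elim: t p => //= l IHl r IHr p; rewrite !mem_cat inE !negb_or.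
case/orP => vt; have vs := leaves_from_suffix vt.
  rewrite IHl //=; apply/andP; split.
    by apply/eqP => e; move: vs; rewrite e suffix_child_neq.
  by apply/negP => /carets_from_suffix; exact: suffix_children vs.
rewrite IHr // andbT; apply/andP; split.
  by apply/negP => /carets_from_suffix /suffix_children; exact.
by apply/eqP => e; move: vs; rewrite e suffix_child_neq.
Qed.

Lemma leaf_above p t s : s ++ p \notin carets_from p t ->
  exists s' q, q \in leaves_from p t /\ s ++ p = s' ++ q.
Proof.
elim: t p s => [|l IHl r IHr] p s /=; first by exists s, p; rewrite inE.
(* The last entry of [s] is the first turn taken below [p], so it selects the subtree in which to
   recurse. *)
case/lastP: s => [|s b]; first by rewrite mem_cat inE eqxx orbT.
rewrite cat_rcons mem_cat inE !negb_or => /and3P[nl _ nr].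
case: b nl nr => nl nr; [have [s' [q [qt e]]] := IHr _ _ nr
                        |have [s' [q [qt e]]] := IHl _ _ nl];
by exists s', q; rewrite mem_cat qt ?orbT.
Qed.



Lemma nseq_cat_cons k b p : nseq k b ++ b :: p = nseq k.+1 b ++ p.
Proof. by elim: k => //= k ->. Qed.

(** Here [k] is the length of the left spine. The second clause will show that a child which is not
    a caret forces [k = 0]. *)
Lemma first_leaf p t : exists2 k,
  nth [::] (leaves_from p t) 0 = nseq k false ++ p &
  (0 < k -> p \in carets_from p t)%N.
Proof.
elim: t p => [|l IHl r _] p /=; first by exists 0%N.
have [k e _] := IHl (false :: p).
exists k.+1; last by rewrite mem_cat inE eqxx orbT.
by rewrite nth_cat size_leaves_from /= e nseq_cat_cons.
Qed.

Lemma last_leaf p t : exists2 k,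
  nth [::] (leaves_from p t) (size (carets_from p t)) = nseq k true ++ p &
  (0 < k -> p \in carets_from p t)%N.
Proof.
elim: t p => [|l _ r IHr] p /=; first by exists 0%N.
have [k e _] := IHr (true :: p).
exists k.+1; last by rewrite mem_cat inE eqxx orbT.
rewrite nth_cat size_cat !size_leaves_from /= ltnNge addnS ltnS leq_addr /=.
by rewrite subSS addKn e nseq_cat_cons.
Qed.

(* A vertex lists its last turn first: these two leaves are reached from the caret
   by one turn to a side followed by turns to the other side only. *)
Lemma leaves_around_caret p t n : (n < size (carets_from p t))%N ->
  let c := nth [::] (carets_from p t) n in
  (exists2 k, nth [::] (leaves_from p t) n = nseq k true ++ false :: c &
     (0 < k)%N -> false :: c \in carets_from p t) /\
  (exists2 k, nth [::] (leaves_from p t) n.+1 = nseq k false ++ true :: c &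
     (0 < k)%N -> true :: c \in carets_from p t).
Proof.
elim: t p n => //= l IHl r IHr p n.
rewrite size_cat /= !nth_cat !size_leaves_from => nlt.
(* Caret [n] lies in the left subtree, lies in the right one, or is the root. In the last case the
   two leaves are the last of the left subtree and the first of the right one. *)
have [nl|ln|nl] := ltngtP n (size (carets_from (false :: p) l)).
- have [[k e h] [k' e' h']] := IHl _ _ nl; rewrite ltnS (ltnW nl) ltnS nl.
  split; [exists k => // /h|exists k' => // /h'];
  by rewrite mem_cat => ->.
- rewrite !ltnS leqNgt ln /= (ltnNge n) (ltnW ln) /=.
  case: n nlt ln => // n nlt ln.
  rewrite !subSS !subSn //=.
  have nr : (n - size (carets_from (false :: p) l) < size (carets_from (true :: p) r))%N.
    by rewrite ltn_subLR //; rewrite addnS !ltnS in nlt *.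
  have [[k e h] [k' e' h']] := IHr _ _ nr.
  split; [exists k => // /h|exists k' => // /h'];
  by rewrite mem_cat inE => ->; rewrite !orbT.
- rewrite nl subnn /= ltnSn ltnn subnn.
  have [k e h] := last_leaf (false :: p) l.
  have [k' e' h'] := first_leaf (true :: p) r.
  split; [exists k => // /h|exists k' => // /h'];
  by rewrite mem_cat ?inE => ->; rewrite ?orbT.
Qed.

Lemma exposed_leaves t n : (n < size (carets t))%N ->
  exposed t (nth [::] (carets t) n) ->
  nth [::] (leaves t) n = false :: nth [::] (carets t) n /\
  nth [::] (leaves t) n.+1 = true :: nth [::] (carets t) n.
Proof.
move=> nt /andP[nl nr].
have [[k -> h] [k' -> h']] := leaves_around_caret nt.
case: k h => [_|k /(_ isT) h]; last by rewrite /has_left_child h in nl.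
by case: k' h' => [//|k' /(_ isT) h']; rewrite /has_right_child h' in nr.
Qed.

(** A spine of positive length would give the wrong last turn to one of the two leaves. So both
    spines are trivial, caret [n] is [w], and its children are leaves, hence not carets. *)
Lemma leaves_exposed t n w : (n < size (carets t))%N ->
  nth [::] (leaves t) n = false :: w -> nth [::] (leaves t) n.+1 = true :: w ->
  exposed t (nth [::] (carets t) n).
Proof.
move=> nt el er.
have sl : size (leaves t) = (size (carets t)).+1 := size_leaves_from _ _.
have [[k e _] [k' e' _]] := leaves_around_caret nt.
rewrite -/(leaves t) el in e; rewrite -/(leaves t) er in e'.
case: k e => // e; case: k' e' => // e'.
apply/andP; split; apply: leaf_notin_carets.
  by rewrite -/(leaves t) -[X in X \in _]e -el mem_nth // sl ltnS ltnW.
by rewrite -/(leaves t) -[X in X \in _]e' -er mem_nth // sl.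
Qed.

Lemma exposed_below t v : v \in carets t ->
  exists s, s ++ v \in carets t /\ exposed t (s ++ v).
Proof.
(* As [m] bounds the depth of all carets, [m - size v] drops at each descent to a child caret. *)
have [m le_m] : exists m, forall w, w \in carets t -> (size w <= m)%N.
  by exists (\max_(w <- carets t) size w) => w wt; exact: leq_bigmax_seq.
have [n] := ubnP (m - size v); elim: n v => // n IH v; rewrite ltnS => vn vt.
have [|] := boolP (exposed t v); first by exists [::].
rewrite negb_and !negbK => h.
have [b bt] : exists b, b :: v \in carets t by case/orP: h; eexists; eassumption.
have [||s [st es]] := IH (b :: v) => //.
  by apply: leq_trans vn; rewrite ltn_sub2l //; exact: le_m bt.
by exists (rcons s b); rewrite cat_rcons.
Qed.

End Trees.

(** * Standard dyadic intervals *)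

Section Bad.
Context {R : realType}.
Local Open Scope ring_scope.
Local Notation I := (unit_interval R).
Implicit Types (v w : vertex) (t : tree) (f g : thompson R).

(** The last turn is the head of the list and the lowest binary digit, so this is the rank of [v]
    from the left among all vertices of its depth, starting at 0. *)
Fixpoint position v : nat :=
  if v is b :: v' then (b + (position v').*2)%N else 0%N.

Definition interval_of v : R * R :=
  ((position v)%:R / 2 ^+ size v, (position v).+1%:R / 2 ^+ size v).

Lemma interval_of_child b v : let J := interval_of v in
  interval_of (b :: v) =
  if b then ((J.1 + J.2) / 2, J.2) else (J.1, (J.1 + J.2) / 2).
Proof.
have h : (2 : R) ^+ size v != 0 by rewrite expf_neq0 ?pnatr_eq0.
have e : (position (b :: v))%:R = b%:R + 2 * (position v)%:R :> R.
  by rewrite /= natrD -muln2 natrM mulrC.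
rewrite /interval_of -(natr1 (position v)) -(natr1 (position (b :: v))) e [size (b :: v)]/= exprS.
by case: b {e} => /=; congr pair; field.
Qed.

Lemma interval_of_width v : (interval_of v).2 - (interval_of v).1 = (2 ^+ size v)^-1.
Proof. by rewrite /= -mulrBl -natrB // subSnn mul1r. Qed.

Lemma interval_of_lt v : (interval_of v).1 < (interval_of v).2.
Proof. by rewrite -subr_gt0 interval_of_width invr_gt0 exprn_gt0. Qed.

(** The width gives the depth and the left endpoint then gives the position, whose binary digits,
    read off by parity, are the turns. *)
Lemma interval_of_inj : injective interval_of.
Proof.
move=> v w e.
have h (u : vertex) : (2 : R) ^+ size u != 0 by rewrite expf_neq0 ?pnatr_eq0.
have es : size v = size w.
  have : (2 : R) ^+ size v = 2 ^+ size w.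
    by apply: invr_inj; rewrite -!interval_of_width e.
  by apply: ieexprIn => //; rewrite -subr_eq0 addrK oner_eq0.
have : position v = position w.
  move: e => /(congr1 fst) /=; rewrite es => /(mulIf (invr_neq0 (h w))) /eqP.
  by rewrite eqr_nat => /eqP.
elim: v w es {e} => [|b v IH] [|c w] //= [es] e.
have eb : b = c.
  by have := congr1 odd e; rewrite !oddD !odd_double !addbF !oddb.
by congr cons => //; apply: IH => //; move: e; rewrite eb => /addnI/double_inj.
Qed.

Lemma interval_of_ge0 v : 0 <= (interval_of v).1.
Proof. by rewrite /= divr_ge0 ?exprn_ge0. Qed.

Lemma interval_of_le1 v : (interval_of v).2 <= 1.
Proof.
elim: v => [|b v IH]; first by rewrite /= divr1.
have := interval_of_lt v; rewrite interval_of_child.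
by case: (interval_of v) IH => a c; case: b => /=; lra.
Qed.

Lemma subdivisionE t v a b : interval_of v = (a, b) ->
  subdivision t a b = [seq interval_of w | w <- leaves_from v t].
Proof.
elim: t v a b => [|l IHl r IHr] v a b e /=; first by rewrite e.
by rewrite map_cat (IHl (false :: v)) ?(IHr (true :: v)) // interval_of_child e.
Qed.

Lemma leaf_intervalsE t : leaf_intervals t = [seq interval_of w | w <- leaves t].
Proof. by apply: subdivisionE; rewrite /interval_of /= !divr1. Qed.

(** * Affine maps between standard dyadic intervals *)

Definition maps_interval g v w := forall x : I,
  (interval_of v).1 <= \val x <= (interval_of v).2 ->
  \val (g x) = affine_map (interval_of v) (interval_of w) (\val x).

Lemma affine_map_mem v w x :
  (interval_of v).1 <= x <= (interval_of v).2 ->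
  (interval_of w).1 <= affine_map (interval_of v) (interval_of w) x
    <= (interval_of w).2.
Proof.
have lv := interval_of_lt v; have lw := interval_of_lt w.
rewrite -(affine_map1 (interval_of v) (interval_of w)).
by rewrite -(affine_map2 (interval_of w) lv) !affine_map_le.
Qed.

Lemma interval_of_memI v x :
  (interval_of v).1 <= x <= (interval_of v).2 -> x \in I.
Proof.
move=> /andP[h1 h2]; apply: memI; first exact: le_trans (interval_of_ge0 v) h1.
exact: le_trans h2 (interval_of_le1 v).
Qed.

Definition point_of v x (vx : (interval_of v).1 <= x <= (interval_of v).2) : I :=
  exist _ x (interval_of_memI vx).

Lemma maps_interval_comp f g v w z :
  maps_interval g v w -> maps_interval f w z -> maps_interval (f * g)%g v z.
Proof.
move=> gvw fwz x xv; rewrite [LHS](fwz (g x)) gvw //; last exact: affine_map_mem.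
have := interval_of_lt v; have := interval_of_lt w; rewrite /affine_map.
case: (interval_of v) (interval_of w) (interval_of z) => [a b] [a' b'] [a'' b''].
rewrite -subr_gt0 => /= lw; rewrite -subr_gt0 => /= lv.
by field; rewrite !gt_eqF.
Qed.

Lemma maps_interval_inv g v w : maps_interval g v w -> maps_interval g^-1%g w v.
Proof.
move=> gvw x xw.
have mv := affine_map_mem v xw.
pose y := point_of mv.
have <- : g y = x.
  by apply/val_inj; rewrite gvw //= affine_mapK ?interval_of_lt.
rewrite [X in \val X]thompson_invK [X in affine_map _ _ X]gvw //=.
by rewrite affine_mapK ?interval_of_lt.
Qed.

(** The images of the two endpoints determine the target interval, and with it the vertex. *)
Lemma maps_interval_funr g v w w' :
  maps_interval g v w -> maps_interval g v w' -> w = w'.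
Proof.
move=> gw gw'; apply: interval_of_inj.
have lv := interval_of_lt v.
have m1 : (interval_of v).1 <= (interval_of v).1 <= (interval_of v).2.
  by rewrite lexx ltW.
have m2 : (interval_of v).1 <= (interval_of v).2 <= (interval_of v).2.
  by rewrite lexx ltW.
pose y1 := point_of m1.
pose y2 := point_of m2.
have := gw' y1 m1; rewrite gw // !affine_map1 => e1.
have := gw' y2 m2; rewrite gw // !affine_map2 // => e2.
by rewrite [LHS]surjective_pairing e1 e2 -surjective_pairing.
Qed.

Lemma maps_interval_inj g v v' w :
  maps_interval g v w -> maps_interval g v' w -> v = v'.
Proof.
by move=> /maps_interval_inv gv /maps_interval_inv; exact: maps_interval_funr.
Qed.

(** An affine map preserves midpoints, so it respects bisection. *)
Lemma maps_interval_child g v w b :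
  maps_interval g v w -> maps_interval g (b :: v) (b :: w).
Proof.
move=> gvw x xb.
have lv := interval_of_lt v; have lw := interval_of_lt w.
rewrite gvw; last first.
  move: xb lv; rewrite interval_of_child.
  by case: (interval_of v) => a c; case: b => /= /andP[h1 h2] ?; lra.
rewrite !interval_of_child /affine_map; move: lv lw {gvw xb}.
case: (interval_of v) (interval_of w) => [a c] [a' c'].
by case: b => /= lv lw; field; rewrite !gt_eqF //; lra.
Qed.

Lemma maps_interval_cat g v w s :
  maps_interval g v w -> maps_interval g (s ++ v) (s ++ w).
Proof. by move=> gvw; elim: s => //= b s; exact: maps_interval_child. Qed.

Lemma pair_maps_leaves T S g : pair_represents T S g ->
  forall i, (i <= size (carets T))%N ->
  maps_interval g (nth [::] (leaves T) i) (nth [::] (leaves S) i).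
Proof.
move=> [_ _ TS h] i iT x.
have sT : size (leaves T) = (size (carets T)).+1 := size_leaves_from _ _.
have sS : size (leaves S) = (size (carets S)).+1 := size_leaves_from _ _.
have := h i; rewrite !leaf_intervalsE size_map sT ltnS => /(_ iT x).
by rewrite !(nth_map [::]) ?sT ?sS -?TS ?ltnS.
Qed.

(** * Counting bad intervals *)

Definition bad g v := ~ exists w, maps_interval g v w.

(** Bounding all duplicate-free lists spares a separate proof that the bad vertices form a finite
    set. *)
Definition bad_at_most g n :=
  forall s : seq vertex, uniq s -> (forall v, v \in s -> bad g v) -> (size s <= n)%N.

(** A vertex that is not a caret lies at or below a leaf, and inherits goodness from it by repeated
    bisection. *)
Lemma bad_at_most_of_leaves g t :
  (forall v, v \in leaves t -> exists w, maps_interval g v w) ->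
  bad_at_most g (size (carets t)).
Proof.
move=> gl s us bs; apply: uniq_leq_size => // v vs.
apply: contraT => vt; exfalso; apply: (bs v vs).
have [|s' [q [qt]]] := @leaf_above [::] t v; first by rewrite cats0.
rewrite cats0 => ->; have [w gw] := gl q qt.
by exists (s' ++ w); exact: maps_interval_cat.
Qed.

Lemma bad_at_most_pair T S g : pair_represents T S g ->
  bad_at_most g (size (carets T)) /\ bad_at_most g^-1%g (size (carets T)).
Proof.
move=> TSg; have [_ _ TS _] := TSg; have h := pair_maps_leaves TSg.
split; last rewrite TS; apply: bad_at_most_of_leaves => v /(nthP [::])[i].
  rewrite [size _]size_leaves_from ltnS => iT <-.
  by exists (nth [::] (leaves S) i); exact: h.
rewrite [size _]size_leaves_from ltnS -/(carets S) -TS => iT <-.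
by exists (nth [::] (leaves T) i); apply: maps_interval_inv; exact: h.
Qed.

Lemma bad_at_mostM f g m n : bad_at_most f m -> bad_at_most g n ->
  bad_at_most (f * g)%g (m + n).
Proof.
move=> fm gn s us bs.
pose good v := `[< exists w, maps_interval g v w >].
(* The default [[::]] is harmless: [img] is applied only to vertices that are good for [g]. *)
pose img v := xget [::] [set w | maps_interval g v w]%classic.
have imgP v : good v -> maps_interval g v (img v).
  by move=> /asboolP[w gw]; exact: (@xgetI _ [::] _ w gw).
(* Vertices of [s] that are bad for [g] number at most [n]. The others are sent by [img] injectively
   to vertices that are bad for [f]. *)
rewrite -(count_predC good) -!size_filter; apply: leq_add; last first.
  apply: gn; first exact: filter_uniq.
  by move=> v; rewrite mem_filter => /andP[/asboolPn].
rewrite -(size_map img); apply: fm.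
  rewrite map_inj_in_uniq ?filter_uniq // => v w.
  rewrite !mem_filter => /andP[/imgP gv _] /andP[/imgP gw _] e.
  by apply: maps_interval_inj gv _; rewrite e.
move=> _ /mapP[v vs ->] [z fz]; move: vs; rewrite mem_filter => /andP[/imgP gv vs].
by apply: (bs v vs); exists z; exact: maps_interval_comp gv fz.
Qed.

Lemma bad_at_most1 : bad_at_most 1%g 0.
Proof.
case=> // v s _ /(_ v (mem_head _ _)); case; exists v => x _ /=.
rewrite /affine_map divff ?mulr1 ?subrKC //.
by rewrite subr_eq0 gt_eqF // interval_of_lt.
Qed.

Lemma bad_at_most_prod (s : seq (thompson R)) k :
  (forall x, x \in s -> bad_at_most x k) ->
  bad_at_most (\prod_(x <- s) x)%g (size s * k).
Proof.
elim: s => [|x s IH] h; first by rewrite big_nil; exact: bad_at_most1.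
rewrite big_cons mulSn; apply: bad_at_mostM; first exact/h/mem_head.
by apply: IH => y ys; apply: h; rewrite inE ys orbT.
Qed.

Lemma size_nu T S g : pair_represents T S g ->
  size (zip (tree_word T) (tree_word S)) = size (carets T).
Proof. by move=> [_ _ TS _]; rewrite size1_zip !size_map // TS. Qed.

Lemma bad_at_most_generators x : generators R x -> bad_at_most x 3.
Proof.
have mono (g : thompson R) m n : (m <= n)%N -> bad_at_most g m -> bad_at_most g n.
  by move=> mn gm s us /(gm s us)/leq_trans; exact.
have h0 : bad_at_most (x0 R) 3 /\ bad_at_most (x0 R)^-1%g 3.
  have [T [S [TS _ /(congr1 size)]]] := projT2 (cid (@x0_exists R)).
  (* The word of [x0] has two letters, hence two carets; the bound is weakened to the three carets
     of [x1]. *)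
  rewrite (size_nu TS) => /= e; have [] := bad_at_most_pair TS.
  by split; apply: mono (_ : (size (carets T) <= 3)%N) _ => //; rewrite -e.
have h1 : bad_at_most (x1 R) 3 /\ bad_at_most (x1 R)^-1%g 3.
  have [T [S [TS _ /(congr1 size)]]] := projT2 (cid (@x1_exists R)).
  by rewrite (size_nu TS) => /= ->; exact: bad_at_most_pair TS.
by case: h0 h1 => ? ? [? ?] [[[->|->]|->]|->].
Qed.

Lemma reduced_carets_bad T S g : pair_represents T S g ->
  (forall n, (n < size (carets T))%N ->
    ~~ (exposed T (nth [::] (carets T) n) && exposed S (nth [::] (carets S) n))) ->
  forall v, v \in carets T -> bad g v.
Proof.
move=> TSg red v vT [w gvw].
have [s [svT esv]] := exposed_below vT.
have gsv := @maps_interval_cat _ _ _ s gvw.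
have [n nT en] := nthP [::] svT; rewrite -en in esv gsv.
have [eF eT] := exposed_leaves nT esv.
have TS : size (carets T) = size (carets S) by case: TSg.
have := red n nT; rewrite esv /= => /negP; apply.
(* By uniqueness of the target, leaves [n] and [n.+1] of [S] are the two children of [s ++ w], so
   caret [n] of [S] is exposed as well. *)
have lF := pair_maps_leaves TSg (ltnW nT); have lT := pair_maps_leaves TSg nT.
apply: (@leaves_exposed _ _ (s ++ w)); first by rewrite -TS.
  by apply: maps_interval_funr lF _; rewrite eF; exact: maps_interval_child.
by apply: maps_interval_funr lT _; rewrite eT; exact: maps_interval_child.
Qed.

End Bad.

Theorem proposition4p3 (R : realType) :
  exists D : nat,
    forall u : seq (letter * letter), caret_type_language R u ->
    forall (g : thompson R) (n : nat),
      nu g u -> word_length (generators R) g n ->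
      (size u <= D * (n + 1))%N.
Proof.
exists 3 => u _ g n [T [S [TSg red ->]]] [[w [wX <- gE]] _].
(* The single caret of the identity pair is not bad; its one letter is absorbed by the summand 1 in
   [n + 1]. *)
rewrite (size_nu TSg); case: red => [[-> _]|red]; first by rewrite addn1.
apply: (@leq_trans (size w * 3)); last by rewrite mulnC leq_mul2l leq_addr.
(* The bound is applied to the list of carets of [T], which are distinct and all bad. *)
have := @bad_at_most_prod _ w 3 (fun x xw => bad_at_most_generators (wX x xw)).
rewrite -gE; apply; first exact: uniq_carets_from.
exact: reduced_carets_bad TSg red.
Qed.
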